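(* There is an algorithm that, given the data $c\in\mathbb{Q}^n$, $d,q\in\mathbb{Q}^m$, $A\in\mathbb{Q}^{k\times n}$, $B\in\mathbb{Q}^{k\times m}$, $a\in\mathbb{Q}^k$, $T\in\mathbb{Q}^{r\times n}$, $W\in\mathbb{Q}^{r\times m}$, $h\in\mathbb{Q}^r$ of a bilevel linear program (BLP) (optimistic scenario, as defined in the context), computes in time polynomial in the encoding length of this data numbers $M_p,M_d$ that are bilevel-correct for (BLP).
   Context: The bilevel linear program (BLP), in the optimistic scenario, is $$\min\ c^\top x+d^\top y\quad\text{s.t.}\quad Ax+By=a,\ x\ge 0,\ y\in\operatorname{argmin}\{q^\top\bar y\mid Tx+W\bar y=h,\ \bar y\ge 0\},$$ i.e., a pair $(x,y)$ is feasible if $x\ge 0$, $Ax+By=a$, and $y$ is an optimal solution of the lower level program $\min\{q^\top \bar y\mid Tx+W\bar y=h,\ \bar y\ge0\}$ (so $x$ is infeasible if the lower level program is infeasible or unbounded, or no optimal lower level solution satisfies $Ax+By=a$). Using lower level optimality conditions, (BLP) is equivalent to the KKT reformulation $$\min\ c^\top x+d^\top y\ \ \text{s.t.}\ \ Ax+By=a,\ x\ge 0,\ Tx+Wy=h,\ y\ge 0,\ W^\top\lambda\le q,\ y^\top(q-W^\top\lambda)=0,$$ with variables $x\in\mathbb{R}^n$, $y\in\mathbb{R}^m$, $\lambda\in\mathbb{R}^r$. The big-M reformulation with parameters $M_p,M_d\in\mathbb{R}$ replaces the complementarity constraint $y^\top(q-W^\top\lambda)=0$ by binary variables $z_i\in\{0,1\}$,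 $i=1,\dots,m$, and constraints $y_i\le M_p(1-z_i)$ and $(q-W^\top\lambda)_i\le M_d z_i$ for all $i$, yielding a mixed-integer linear program. The values $M_p,M_d$ are called bilevel-correct if this mixed-integer linear program is an equivalent reformulation of (BLP), i.e., whenever (BLP) has an optimal solution, the mixed-integer program has an optimal solution with the same optimal value (equivalently, the bounds $y_i\le M_p$, $(q-W^\top\lambda)_i\le M_d$ do not cut off all optimal solutions of the KKT reformulation). *)

(* Defs.v *)
From HB Require Import structures.
From mathcomp Require Import all_boot all_order all_algebra.
From mathcomp Require Import reals.
Set Implicit Arguments. Unset Strict Implicit. Unset Printing Implicit Defensive.
Import Order.TTheory GRing.Theory Num.Theory.
Local Open Scope ring_scope.

Section BLP.
Variable R : realType.

Definition dotv (p : nat) (u v : 'cV[R]_p) : R := \sum_(i < p) u i 0 * v i 0.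
Definition nonneg (p : nat) (u : 'cV[R]_p) : Prop := forall i, 0 <= u i 0.

Variables (n m k r : nat).
Variables (c : 'cV[R]_n) (d q : 'cV[R]_m) (A : 'M[R]_(k, n)) (B : 'M[R]_(k, m))
  (a : 'cV[R]_k) (T : 'M[R]_(r, n)) (W : 'M[R]_(r, m)) (h : 'cV[R]_r).

Definition blp_obj (x : 'cV[R]_n) (y : 'cV[R]_m) : R := dotv c x + dotv d y.

Definition ll_feasible (x : 'cV[R]_n) (yb : 'cV[R]_m) : Prop :=
  T *m x + W *m yb = h /\ nonneg yb.

Definition ll_optimal (x : 'cV[R]_n) (y : 'cV[R]_m) : Prop :=
  ll_feasible x y /\ forall yb, ll_feasible x yb -> dotv q y <= dotv q yb.

Definition blp_feasible (x : 'cV[R]_n) (y : 'cV[R]_m) : Prop :=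
  nonneg x /\ A *m x + B *m y = a /\ ll_optimal x y.

Definition blp_optimal (x : 'cV[R]_n) (y : 'cV[R]_m) : Prop :=
  blp_feasible x y /\
  forall x' y', blp_feasible x' y' -> blp_obj x y <= blp_obj x' y'.

Definition milp_feasible (Mp Md : R) (x : 'cV[R]_n) (y : 'cV[R]_m)
    (lam : 'cV[R]_r) (z : 'I_m -> bool) : Prop :=
  A *m x + B *m y = a /\ nonneg x /\ T *m x + W *m y = h /\ nonneg y /\
  (forall i, (W^T *m lam) i 0 <= q i 0) /\
  (forall i, y i 0 <= Mp * (1 - (z i)%:R)) /\
  (forall i, (q - W^T *m lam) i 0 <= Md * (z i)%:R).

Definition milp_optimal (Mp Md : R) x y lam z : Prop :=
  milp_feasible Mp Md x y lam z /\
  forall x' y' lam' z', milp_feasible Mp Md x' y' lam' z' ->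
    blp_obj x y <= blp_obj x' y'.

Definition bilevel_correct (Mp Md : R) : Prop :=
  forall x y, blp_optimal x y ->
    exists x' y' lam z, milp_optimal Mp Md x' y' lam z /\
      blp_obj x' y' = blp_obj x y.

End BLP.

Inductive sym := S0 | S1 | SSep | SBlank.
Inductive move := MLeft | MRight | MStay.

Record TM := {
  tm_N : nat;
  tm_start : 'I_tm_N.+1;
  tm_halt : 'I_tm_N.+1;
  tm_delta : 'I_tm_N.+1 -> sym -> 'I_tm_N.+1 * sym * move }.

(* configuration: state, tape left of head (nearest first), head symbol,
   tape right of head *)
Record config (M : TM) := Config {
  cf_state : 'I_(tm_N M).+1;
  cf_left : seq sym;
  cf_head : sym;
  cf_right : seq sym }.

Definition tm_step (M : TM) (cf : config M) : config M :=
  let: Config s l x rt := cf in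
  if s == tm_halt M then cf else
  let: (s', w, mv) := tm_delta s x in
  match mv with
  | MStay => Config s' l w rt
  | MLeft => match l with
             | [::] => Config s' [::] SBlank (w :: rt)
             | y :: l' => Config s' l' y (w :: rt)
             end
  | MRight => match rt with
              | [::] => Config s' (w :: l) SBlank [::]
              | y :: rt' => Config s' (w :: l) y rt'
              end
  end.

Definition tm_init (M : TM) (w : seq sym) : config M :=
  match w with
  | [::] => Config (tm_start M) [::] SBlank [::]
  | x :: w' => Config (tm_start M) [::] x w'
  end.

Definition tm_run (M : TM) (w : seq sym) (t : nat) : config M :=
  iter t (@tm_step M) (tm_init M w).

Fixpoint take_nonblank (s : seq sym) : seq sym :=
  match s with
  | [::] => [::]
  | SBlank :: _ => [::]
  | x :: s' => x :: take_nonblank s'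
  end.

Definition tm_output (M : TM) (cf : config M) : seq sym :=
  take_nonblank (cf_head cf :: cf_right cf).

Definition tm_computes_in (M : TM) (w : seq sym) (t : nat) (out : seq sym) : Prop :=
  cf_state (tm_run M w t) = tm_halt M /\ tm_output (tm_run M w t) = out.

Fixpoint bin_aux (fuel x : nat) : seq sym :=
  match fuel with
  | 0 => [::]
  | fuel'.+1 => if x == 0 then [::]
                else (if odd x then S1 else S0) :: bin_aux fuel' x./2
  end.
Definition bin (x : nat) : seq sym := bin_aux x x.   (* little endian *)

Definition enc_nat (x : nat) : seq sym := bin x ++ [:: SSep].
Definition enc_int (z : int) : seq sym :=
  (if z < 0 then S1 else S0) :: bin `|z|%N.
Definition enc_rat (x : rat) : seq sym :=
  enc_int (numq x) ++ SSep :: bin `|denq x|%N ++ [:: SSep].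

Definition enc_mat (p s : nat) (M : 'M[rat]_(p, s)) : seq sym :=
  flatten [seq flatten [seq enc_rat (M i j) | j <- enum 'I_s] | i <- enum 'I_p].

Definition enc_blp (n m k r : nat) (c : 'cV[rat]_n) (d q : 'cV[rat]_m)
  (A : 'M[rat]_(k, n)) (B : 'M[rat]_(k, m)) (a : 'cV[rat]_k)
  (T : 'M[rat]_(r, n)) (W : 'M[rat]_(r, m)) (h : 'cV[rat]_r) : seq sym :=
  enc_nat n ++ enc_nat m ++ enc_nat k ++ enc_nat r ++
  enc_mat c ++ enc_mat d ++ enc_mat q ++ enc_mat A ++ enc_mat B ++ enc_mat a ++
  enc_mat T ++ enc_mat W ++ enc_mat h.

Definition rmx (R : realType) (p s : nat) (M : 'M[rat]_(p, s)) : 'M[R]_(p, s) :=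
  map_mx (fun x : rat => ratr x) M.

(* Main.v *)
Require Import Defs.
From HB Require Import structures.
From mathcomp Require Import all_boot all_order all_algebra fingroup perm.
From mathcomp Require Import boolp reals zify ring lra.
Set Implicit Arguments. Unset Strict Implicit. Unset Printing Implicit Defensive.
Import Order.TTheory GRing.Theory Num.Theory.
Local Open Scope ring_scope.

(* With [L] the length of the encoded input, [2 ^ (L - 1)] and [2 ^ (2 L)] are
   bilevel-correct, so a machine only has to print a number of zeros linear in [L].

   Let (x, y) be optimal for (BLP), with a multiplier [lam] given by Farkas' lemma.
   Shrinking supports turns (x, y) into a basic solution of [A x + B y = a],
   [T x + W y = h] and the splitting of [lam] with the slack [q - W^T lam] into a
   basic solution of the dual system. Since supports only shrink, complementarity
   (hence lower level optimality) survives, and the objective does not change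
   because (x, y) was already optimal. Entries of a basic solution are
   ratios of determinants, and [|det S| <= prod (1 + |S i j|)], while a nonzero
   [det S] is at least the inverse of the product of the denominators of [S]: both
   are bounded by 2 to the total encoding length of the entries. *)

(** * Farkas' lemma and basic solutions *)

(* Bartl's induction on the number of constraints: if [c] is not already implied
   by the remaining constraints, a violating [y] satisfies [a ord0 y > 0], and
   projecting along [y] onto the kernel of [a ord0] eliminates that constraint. *)
Lemma farkas_family (F : realFieldType) p s (a : 'I_s -> 'rV[F]_p) (c : 'rV[F]_p) :
  (forall x : 'cV_p, (forall i, (a i *m x) 0 0 <= 0) -> (c *m x) 0 0 <= 0) ->
  exists2 l : 'I_s -> F, (forall i, 0 <= l i) & c = \sum_i l i *: a i.
Proof.
elim: s a c => [|s IH] a c ac.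
  exists (fun=> 0) => //; rewrite big_ord0; apply/rowP => j; rewrite mxE.
  have := ac c^T; rewrite mxE => /(_ (fun i => False_ind _ (notF (ltn_ord i)))) le0.
  have E : \sum_j c 0 j * c^T j 0 = \sum_j c 0 j ^+ 2.
    by apply: eq_bigr => k _; rewrite mxE.
  have: \sum_j c 0 j ^+ 2 == 0.
    by rewrite eq_le -{1}E le0 sumr_ge0 // => k _; rewrite sqr_ge0.
  rewrite psumr_eq0 => [/allP/(_ j)|k _]; last by rewrite sqr_ge0.
  by rewrite mem_index_enum sqrf_eq0 => /(_ isT)/eqP.
pose a' i := a (lift ord0 i).
case: (pselect (forall x : 'cV_p, (forall i, (a' i *m x) 0 0 <= 0) ->
    (c *m x) 0 0 <= 0)) => [/IH[l l_ge0 cE]|].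
  exists (fun i => if unlift ord0 i is Some j then l j else 0) => [i|].
    by case: unlift.
  rewrite big_ord_recl unlift_none scale0r add0r cE.
  by apply: eq_bigr => i _; rewrite liftK.
move=> /existsNP[y /not_implyP[a'y /negP]]; rewrite -ltNge => cy.
have ay : 0 < (a ord0 *m y) 0 0.
  rewrite ltNge; apply/negP => ay0; move: cy; rewrite ltNge => /negP; apply.
  apply: ac => i; case: (unliftP ord0 i) => [j|] -> //; exact: a'y.
set t := (a ord0 *m y) 0 0 in ay.
pose pr (b : 'rV[F]_p) := b - ((b *m y) 0 0 / t) *: a ord0.
have prE b x : (pr b *m x) 0 0 = (b *m (x - ((a ord0 *m x) 0 0 / t) *: y)) 0 0.
  rewrite /pr mulmxBl mulmxBr -scalemxAl -scalemxAr !mxE; field; exact: lt0r_neq0.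
have [x a'x|l l_ge0 cE] := IH (fun i => pr (a' i)) (pr c).
  rewrite prE; apply: ac => i; case: (unliftP ord0 i) => [j|] ->.
    by rewrite -prE; apply: a'x.
  by rewrite -prE /pr -/t divff ?lt0r_neq0 // scale1r subrr mul0mx mxE.
exists (fun i => if unlift ord0 i is Some j then l j else
    (c *m y) 0 0 / t - \sum_j l j * ((a' j *m y) 0 0 / t)).
  move=> i; case: unlift => // ; rewrite subr_ge0 (@le_trans _ _ 0) //.
    rewrite -oppr_ge0 -sumrN sumr_ge0 // => j _; rewrite -mulrN mulr_ge0 //.
    by rewrite -mulNr divr_ge0 ?oppr_ge0 // ltW.
  by rewrite divr_ge0 ?ltW.
rewrite big_ord_recl unlift_none.
under [X in _ = _ + X]eq_bigr do rewrite liftK.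
have {1}-> : c = pr c + ((c *m y) 0 0 / t) *: a ord0 by rewrite /pr subrK.
rewrite scalerBl scaler_suml {1}cE.
under [X in X + _ = _]eq_bigr do rewrite /pr scalerBr scalerA.
by rewrite sumrB addrAC [RHS]addrC addrA.
Qed.

Lemma farkas (F : realFieldType) p s (A : 'M[F]_(s, p)) (c : 'rV[F]_p) :
  (forall x : 'cV_p, (forall i, (A *m x) i 0 <= 0) -> (c *m x) 0 0 <= 0) ->
  exists2 l : 'rV[F]_s, (forall i, 0 <= l 0 i) & c = l *m A.
Proof.
move=> Ac; have [x Ax|l l_ge0 cE] := @farkas_family F p s (fun i => row i A) c.
  by apply: Ac => i; have := Ax i; rewrite -row_mul mxE.
exists (\row_i l i) => [i|]; first by rewrite mxE.
by rewrite mulmx_sum_row cE; apply: eq_bigr => i _; rewrite mxE.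
Qed.

(** Take the smallest ratio [u i / - v i] over the negative entries of [v]. It is positive because
    those entries lie in the support of [u], and an entry attaining it is driven to zero. *)
Lemma ratio_test (F : realFieldType) N (u v : 'cV[F]_N) :
  (forall i, 0 <= u i 0) -> (forall i, u i 0 = 0 -> 0 <= v i 0) ->
  exists2 t, 0 < t &
    (forall i, 0 <= (u + t *: v) i 0) /\
    ((exists i, v i 0 < 0) -> exists2 i, u i 0 != 0 & (u + t *: v) i 0 = 0).
Proof.
move=> u_ge0 supp.
have [/existsP[i0 vi0]|/existsPn v_ge0] := boolP [exists i, v i 0 < 0]; last first.
  exists 1 => //; split=> [i|[i vi]]; last by have := v_ge0 i; rewrite vi.
  by rewrite scale1r mxE addr_ge0 // leNgt.
have [i vi min] := @arg_minP _ F _ i0 (fun i => v i 0 < 0) (fun i => u i 0 / - v i 0) vi0.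
have ui : u i 0 != 0 by apply: contraTneq vi => /supp; rewrite -leNgt.
have vi' : 0 < - v i 0 by rewrite oppr_gt0.
exists (u i 0 / - v i 0); first by rewrite divr_gt0 // lt_def ui u_ge0.
split=> [j|_]; last first.
  by exists i => //; rewrite !mxE; field; rewrite lt_eqF.
rewrite !mxE; have [vj|vj] := ltP (v j 0) 0; last first.
  by rewrite addr_ge0 // mulr_ge0 // divr_ge0 // ltW.
have := min j vj; rewrite ler_pdivlMr ?oppr_gt0 // mulrN => ?; lra.
Qed.

(** Induction on the size of the support: a nonzero kernel vector inside the support of [u] allows a
    move that zeroes an entry and changes neither [M *m u] nor [f *m u]. Optimality is asked only
    against points with support inside that of [u], since those inherit complementarity. *)
Lemma basic_optimal_solution (F : realFieldType) p N (M : 'M[F]_(p, N)) (f : 'rV[F]_N)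
    (u : 'cV[F]_N) :
  (forall i, 0 <= u i 0) ->
  (forall u' : 'cV_N, (forall i, 0 <= u' i 0) -> (forall i, u i 0 = 0 -> u' i 0 = 0) ->
    M *m u' = M *m u -> (f *m u) 0 0 <= (f *m u') 0 0) ->
  exists u' : 'cV[F]_N,
    [/\ forall i, 0 <= u' i 0, forall i, u i 0 = 0 -> u' i 0 = 0, M *m u' = M *m u,
        f *m u' = f *m u &
        forall v : 'cV_N, (forall i, u' i 0 = 0 -> v i 0 = 0) -> M *m v = 0 -> v = 0].
Proof.
have [s] := ubnP #|[set i | u i 0 != 0]|; elim: s u => // s IH u les u_ge0 opt.
case: (pselect (forall v : 'cV_N, (forall i, u i 0 = 0 -> v i 0 = 0) ->
    M *m v = 0 -> v = 0)) => [indep|]; first by exists u; split.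
move=> /existsNP[v /not_implyP[supp /not_implyP[Mv0 /eqP v_neq0]]].
(* A short step along such a kernel direction stays feasible, so its objective is nonnegative.
   Applied to [v] and [- v], this gives [f *m v = 0]. *)
have fv_ge0 (w : 'cV_N) : (forall i, u i 0 = 0 -> w i 0 = 0) -> M *m w = 0 ->
    0 <= (f *m w) 0 0.
  move=> suppw Mw0; have [i /suppw ->|t t_gt0 [t_ok _]] := @ratio_test _ _ u w u_ge0; first exact: lexx.
  have := opt _ t_ok; rewrite !mulmxDr -!scalemxAr Mw0 scaler0 addr0.
  rewrite [X in _ -> _ -> _ <= X]mxE lerDl [X in _ -> _ -> _ <= X]mxE.
  rewrite pmulr_rge0 //; apply=> // i ui0.
  by rewrite !mxE ui0 suppw // mulr0 addr0.
have suppN i : u i 0 = 0 -> (- v) i 0 = 0 by move=> /supp; rewrite mxE => ->; rewrite oppr0.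
have MvN : M *m - v = 0 by rewrite mulmxN Mv0 oppr0.
have fv0 : f *m v = 0.
  apply/matrixP=> i j; rewrite !ord1 [RHS]mxE; apply/eqP.
  rewrite eq_le fv_ge0 // andbT -oppr_ge0.
  by have := fv_ge0 _ suppN MvN; rewrite mulmxN mxE.
(* One of [v] and [- v] has a negative entry, as the ratio test requires for an entry to vanish. *)
have [w [suppw Mw0 fw0 negw]] : exists w : 'cV_N,
    [/\ forall i, u i 0 = 0 -> w i 0 = 0, M *m w = 0, f *m w = 0 &
        exists i, w i 0 < 0].
  have /cV0Pn[i] := v_neq0; rewrite neq_lt => /orP[vi|vi].
    by exists v; split=> //; exists i.
  exists (- v); split=> //; first by rewrite mulmxN fv0 oppr0.
  by exists i; rewrite mxE oppr_lt0.
have [i /suppw ->|t t_gt0 [t_ok /(_ negw)[i ui ti]]] := @ratio_test _ _ u w u_ge0.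
  exact: lexx.
set u' := u + t *: w in t_ok ti.
have supp' j : u j 0 = 0 -> u' j 0 = 0.
  by move=> uj0; rewrite !mxE uj0 suppw // mulr0 addr0.
have Mu' : M *m u' = M *m u by rewrite mulmxDr -scalemxAr Mw0 scaler0 addr0.
have fu' : f *m u' = f *m u by rewrite mulmxDr -scalemxAr fw0 scaler0 addr0.
have [|| u'' [h1 h2 h3 h4 h5]] := IH u' _ t_ok.
- apply: leq_trans (proper_card _) _; last exact: les.
  apply/properP; split; last by exists i; rewrite inE ?ui // ti eqxx.
  apply/subsetP => j; rewrite !inE; apply: contraNneq => /supp' ->; exact: eqxx.
- move=> z z_ge0 suppz Mz; rewrite fu'; apply: opt => //; last by rewrite Mz.
  by move=> j /supp' /suppz.
by exists u''; split=> //; rewrite ?h3 ?h4 // => j /supp' /h2.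
Qed.

(** * Determinant bounds *)

Lemma sum_le_prodD1 (F : realFieldType) (I : finType) (f : I -> F) :
  (forall i, 0 <= f i) -> 1 + \sum_i f i <= \prod_i (1 + f i).
Proof.
move=> f_ge0.
have [] : 0 <= \sum_i f i /\ 1 + \sum_i f i <= \prod_i (1 + f i).
  elim/big_rec2: _ => [|i x y _ [y_ge0 le_yx]]; first by rewrite addr0.
  split; first by rewrite addr_ge0.
  have := f_ge0 i; nra.
by [].
Qed.

(** Expanding the product of the row sums of absolute values gives one term per map of indices; the
    Leibniz terms are the injective ones. Factors [1 + |S i j|], all at least 1, make the bound
    monotone under passing to submatrices. *)
Lemma le_det_prod (F : realFieldType) p (S : 'M[F]_p) :
  `|\det S| <= \prod_i \prod_j (1 + `|S i j|).
Proof.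
apply: le_trans (ler_norm_sum _ _ _) _.
apply: (@le_trans _ _ (\prod_i \sum_j `|S i j|)); last first.
  apply: ler_prod => i _; rewrite sumr_ge0 //=.
  by apply: le_trans (sum_le_prodD1 _) => //; rewrite lerDr.
rewrite bigA_distr_bigA /=.
under eq_bigr do rewrite normrM normrX normrN1 expr1n mul1r normr_prod.
rewrite [leRHS](bigID (fun f : {ffun 'I_p -> 'I_p} => injectiveb f)) /=.
rewrite ler_wpDr ?sumr_ge0 // => [f _|]; first by rewrite prodr_ge0.
rewrite [leRHS](reindex (@pval _)) /=; last first.
  pose in_Sn := insubd (1%g : 'S_p).
  by exists in_Sn => /= f Uf; first apply: val_inj; apply: insubdK.
rewrite le_eqVlt; apply/orP; left; apply/eqP.
apply: eq_big => [s | s _]; rewrite ?(valP s) //.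
by apply: eq_bigr => i _; rewrite pvalE.
Qed.

Lemma le_prod_inj (F : realFieldType) (I J : finType) (g : J -> I) (f : I -> F) :
  injective g -> (forall i, 1 <= f i) -> \prod_j f (g j) <= \prod_i f i.
Proof.
move=> g_inj f_ge1.
have -> : \prod_j f (g j) = \prod_(i in g @: setT) f i.
  rewrite big_imset /=; last by move=> ? ? _ _; apply: g_inj.
  by apply: eq_bigl => j; rewrite inE.
rewrite [leRHS](bigID (mem (g @: setT))) /= ler_peMr //.
  by rewrite prodr_ge0 // => i _; apply: le_trans (f_ge1 i).
by elim/big_rec: _ => // i x _ x_ge1; have := f_ge1 i; nra.
Qed.

Lemma prodr_ge1 (F : realFieldType) (I : finType) (f : I -> F) :
  (forall i, 1 <= f i) -> 1 <= \prod_i f i.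
Proof.
move=> f_ge1; elim/big_rec: _ => // i x _ x_ge1; have := f_ge1 i; nra.
Qed.

Lemma le_prod2_inj (F : realFieldType) (I J I' J' : finType) (f : I' -> I)
    (g : J' -> J) (w : I -> J -> F) :
  injective f -> injective g -> (forall i j, 1 <= w i j) ->
  \prod_i \prod_j w (f i) (g j) <= \prod_i \prod_j w i j.
Proof.
move=> f_inj g_inj w_ge1.
apply: le_trans (le_prod_inj f_inj _) => [|i]; last exact: prodr_ge1.
apply: ler_prod => i _; apply/andP; split.
  by rewrite prodr_ge0 // => j _; apply: le_trans (w_ge1 _ _).
exact: (le_prod_inj g_inj (w_ge1 (f i))).
Qed.

(** For a reduced fraction this is the absolute numerator plus the denominator. The factor [1 + |a|]
    serves upper bounds on determinants, the denominator serves the lower bound. *)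
Definition height (a : rat) : rat := (1 + `|a|) * (denq a)%:~R.

Lemma denq_ge1 (a : rat) : 1 <= (denq a)%:~R :> rat.
Proof. by rewrite ler1z -gtz0_ge1 denq_gt0. Qed.

Lemma height_ge1 (a : rat) : 1 <= height a.
Proof. by rewrite mulr_ege1 ?denq_ge1 // lerDl. Qed.

(** Each Leibniz term uses one entry per row, so multiplying by all denominators gives an integer,
    and a nonzero integer has absolute value at least 1. *)
Lemma det_ge_den p (S : 'M[rat]_p) : \det S != 0 ->
  1 <= `|\det S| * \prod_i \prod_j (denq (S i j))%:~R.
Proof.
set D := (X in _ * X) => dS.
have D_ge1 : 1 <= D by apply: prodr_ge1 => i; apply: prodr_ge1 => j; exact: denq_ge1.
have D_gt0 : 0 < D by apply: lt_le_trans D_ge1.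
have -> : `|\det S| * D = `|\det S * D| by rewrite normrM (gtr0_norm D_gt0).
apply: norm_intr_ge1; last by rewrite mulf_neq0 // gt_eqF.
rewrite mulr_suml rpred_sum // => s _; rewrite -mulrA rpredM ?rpredX ?rpredN //.
rewrite -big_split /= rpred_prod // => i _.
rewrite (bigD1 (s i)) //= mulrA -numqE rpredM ?rpred_int //.
by rewrite rpred_prod // => j _; rewrite rpred_int.
Qed.

(** Cramer's rule: [\det S] times [v j 0] is an entry of [\adj S *m b], and cofactors are
    determinants of submatrices of [S]. The lower bound [det_ge_den] replaces the division by
    [\det S]. *)
Lemma cramer_bound p (S : 'M[rat]_p) (b v : 'cV[rat]_p) :
  \det S != 0 -> S *m v = b ->
  forall j, `|v j 0| <= \prod_i \prod_j height (S i j) * \prod_i height (b i 0).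
Proof.
move=> dS Sv j; set P := \prod_i \prod_j (1 + `|S i j|).
have w_ge1 i k : 1 <= 1 + `|S i k| by rewrite lerDl.
have P_ge0 : 0 <= P.
  by rewrite prodr_ge0 // => i _; rewrite prodr_ge0 // => k _; rewrite addr_ge0.
have cof i : `|cofactor S i j| <= P.
  rewrite normrM normrX normrN1 expr1n mul1r (le_trans (le_det_prod _)) //.
  under eq_bigr do under eq_bigr do rewrite !mxE.
  exact: (le_prod2_inj (@lift_inj _ i) (@lift_inj _ j) w_ge1).
have num : `|\det S| * `|v j 0| <= P * \prod_i (1 + `|b i 0|).
  rewrite -normrM (_ : _ * _ = (\adj S *m b) j 0); last first.
    by rewrite -Sv mulmxA mul_adj_mx mul_scalar_mx mxE.
  rewrite mxE (le_trans (ler_norm_sum _ _ _)) //.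
  apply: (@le_trans _ _ (P * \sum_i `|b i 0|)).
    rewrite mulr_sumr ler_sum // => i _; rewrite normrM mxE.
    by rewrite ler_wpM2r.
  by rewrite ler_wpM2l // (le_trans _ (sum_le_prodD1 _)) // lerDr.
have -> : \prod_i \prod_j height (S i j) =
    P * \prod_i \prod_j (denq (S i j))%:~R.
  by rewrite -big_split; apply: eq_bigr => i _; rewrite -big_split.
have hb : \prod_i (1 + `|b i 0|) <= \prod_i height (b i 0).
  apply: ler_prod => i _; rewrite addr_ge0 //= ler_peMr ?denq_ge1 // addr_ge0 //.
set D := \prod_i \prod_j (denq _)%:~R.
have D_ge0 : 0 <= D.
  by rewrite prodr_ge0 // => i _; rewrite prodr_ge0 // => k _; rewrite ler0z ltW ?denq_gt0.
apply: le_trans (_ : `|\det S| * `|v j 0| * D <= _).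
  by rewrite mulrAC ler_peMl // det_ge_den.
rewrite [leRHS]mulrAC; apply: ler_wpM2r => //; apply: le_trans num _.
exact: ler_wpM2l.
Qed.

(** The support of [u] selects independent columns, and suitable rows turn them into an invertible
    rational system. Its solution is rational although [u] lives over [F], so Cramer's bound
    applies; heights are at least 1, so the submatrix may be replaced by [M]. *)
Lemma indep_columns_bound (F : realFieldType) p N (M : 'M[rat]_(p, N)) (b : 'cV[rat]_p)
    (u : 'cV[F]_N) :
  map_mx ratr M *m u = map_mx ratr b ->
  (forall v : 'cV[F]_N, (forall i, u i 0 = 0 -> v i 0 = 0) ->
     map_mx ratr M *m v = 0 -> v = 0) ->
  forall j, `|u j 0| <= ratr (\prod_i \prod_j height (M i j) * \prod_i height (b i 0)).
Proof.
move=> Mu indep j0.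
have [->|uj0] := eqVneq (u j0 0) 0.
  rewrite normr0 ler0q mulr_ge0 // prodr_ge0 // => i _; rewrite ?prodr_ge0 // => *;
    by rewrite (le_trans _ (height_ge1 _)).
pose J := [set j | u j 0 != 0]; have Jj0 : j0 \in J by rewrite inE.
pose g (k : 'I_#|J|) := enum_val k; have g_inj : injective g by exact: enum_val_inj.
pose C := colsub g (map_mx ratr M : 'M[F]_(p, N)).
(* [E] extends a vector on the support by zeros, which embeds the kernel of [C] into that of the
   full matrix. *)
pose E := colsub g 1%:M : 'M[F]_(N, #|J|).
have CE : C = map_mx ratr M *m E by rewrite mulmx_colsub mulmx1.
have rE : rowsub g E = 1%:M by apply/matrixP => i k; rewrite !mxE (inj_eq g_inj).
have C_full : row_full C.
  rewrite /row_full -mxrank_tr; apply: inj_row_free => v /(congr1 trmx).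
  rewrite trmx_mul trmxK trmx0 CE -mulmxA => /indep Ev.
  have {Ev} Ev : E *m v^T = 0.
    apply: Ev => i ui; rewrite mxE big1 // => k _; rewrite !mxE.
    case: eqVneq => [ik|]; last by rewrite mul0r.
    by have := enum_valP k; rewrite -/(g k) inE -ik ui eqxx.
  apply: trmx_inj; rewrite trmx0 -[LHS]mul1mx -rE mul_rowsub_mx Ev.
  by apply/matrixP => i k; rewrite !mxE.
pose f := fullrankfun C_full; pose S := mxsub f g M.
have S'E : map_mx ratr S = rowsub f C by apply/matrixP => i k; rewrite !mxE.
have S_unit : S \in unitmx.
  by rewrite -(@map_unitmx _ F ratr) S'E fullrowsub_unit.
have Eu : E *m rowsub g u = u.
  apply/colP => i; rewrite mxE.
  under eq_bigr do rewrite !mxE.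
  have [ui0|ui] := eqVneq (u i 0) 0.
    rewrite ui0 big1 // => k _; case: eqVneq => [<-|]; last by rewrite mul0r.
    by rewrite ui0 mulr0.
  have iJ : i \in J by rewrite inE.
  rewrite (bigD1 (enum_rank_in iJ i)) //= /g enum_rankK_in // eqxx mul1r big1 ?addr0 //.
  move=> k kN; case: eqVneq => [ik|]; last by rewrite mul0r.
  by case/eqP: kN; apply: enum_val_inj; rewrite enum_rankK_in.
have Su : map_mx ratr S *m rowsub g u = map_mx ratr (rowsub f b).
  rewrite S'E mul_rowsub_mx CE -mulmxA Eu Mu.
  by apply/matrixP => i k; rewrite !mxE.
pose v := invmx S *m rowsub f b.
have Sv : S *m v = rowsub f b by rewrite mulmxA mulmxV // mul1mx.
have uv : rowsub g u = map_mx ratr v.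
  have S'_unit : map_mx ratr S \in @unitmx F _ by rewrite map_unitmx.
  rewrite -[LHS](mulKmx S'_unit) Su -Sv map_mxM mulKmx //.
pose k0 := enum_rank_in Jj0 j0.
have -> : u j0 0 = ratr (v k0 0).
  have := congr1 (fun A : 'cV[F]__ => A k0 0) uv.
  by rewrite !mxE /g enum_rankK_in.
rewrite -ratr_norm ler_rat; apply: le_trans (cramer_bound _ Sv _) _.
  by rewrite -unitfE -unitmxE.
have h_ge0 (a : rat) : 0 <= height a by rewrite (le_trans _ (height_ge1 _)).
apply: ler_pM.
- by rewrite prodr_ge0 // => i _; rewrite prodr_ge0.
- by rewrite prodr_ge0.
- under eq_bigr do under eq_bigr do rewrite mxE.
  apply: (@le_prod2_inj _ _ _ _ _ f g (fun i j => height (M i j))) => //.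
    exact: fullrankfun_inj.
  by move=> i j; exact: height_ge1.
- under eq_bigr do rewrite mxE.
  apply: (@le_prod_inj _ _ _ f (fun i => height (b i 0))).
    exact: fullrankfun_inj.
  by move=> i; exact: height_ge1.
Qed.

(** * Optimality conditions *)

Lemma dotvE (R : realType) p (u v : 'cV[R]_p) : dotv u v = (u^T *m v) 0 0.
Proof. by rewrite mxE; apply: eq_bigr => i _; rewrite mxE. Qed.

Section LowerLevel.
Variables (R : realType) (n m r : nat) (q : 'cV[R]_m) (T : 'M[R]_(r, n))
  (W : 'M[R]_(r, m)) (h : 'cV[R]_r) (x : 'cV[R]_n).

(** Weak duality: with slack [s], the cost of [v] is [s^T v + lam^T W v]. The second term agrees at
    all feasible points; the first is zero at [y] and nonnegative elsewhere. *)
Lemma kkt_ll_optimal (y : 'cV[R]_m) (lam : 'cV[R]_r) :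
  ll_feasible T W h x y -> (forall i, (W^T *m lam) i 0 <= q i 0) ->
  (forall i, y i 0 * (q - W^T *m lam) i 0 = 0) ->
  ll_optimal q T W h x y.
Proof.
move=> feas dual compl; split=> // yb feasb.
have Wy : W *m yb = W *m y.
  by apply: (addrI (T *m x)); rewrite feas.1 feasb.1.
pose s := q - W^T *m lam.
have dotE v : dotv q v = dotv s v + (lam^T *m (W *m v)) 0 0.
  rewrite !dotvE /s linearB /= mulmxBl trmx_mul trmxK mulmxA.
  by rewrite [X in _ = X + _]mxE [X in _ = _ + X + _]mxE subrK.
rewrite !dotE Wy lerD2r {1}/dotv big1; last by move=> i _; rewrite mulrC.
apply: sumr_ge0 => i _; rewrite mulr_ge0 ?feasb.2 //.
by rewrite /s mxE [X in _ + X]mxE subr_ge0.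
Qed.

(** Farkas' lemma for the directions [v] with [W *m v = 0] that are nonnegative where [y] vanishes:
    a small step along them is feasible, so optimality makes their cost nonnegative. *)
Lemma ll_optimal_multiplier (y : 'cV[R]_m) : ll_optimal q T W h x y ->
  exists2 lam : 'cV[R]_r, (forall i, (W^T *m lam) i 0 <= q i 0) &
    forall i, y i 0 != 0 -> (q - W^T *m lam) i 0 = 0.
Proof.
move=> [[Ty y_ge0] opt].
(* Row [i] of [D] encodes [- v i <= 0] when [y i = 0] and is zero otherwise, so the slack obtained
   from it is supported on the zeros of [y]. *)
pose D : 'M[R]_m := diag_mx (\row_i - (y i 0 == 0)%:R).
have [v Av|l l_ge0 cE] := @farkas _ _ _ (col_mx (col_mx W (- W)) D) (- q^T).
  rewrite mulNmx mxE oppr_le0 -dotvE.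
  have Wv : W *m v = 0.
    apply/colP => i; apply: le_anti; rewrite [X in _ <= X <= _]mxE.
    have := Av (lshift m (lshift r i)); have := Av (lshift m (rshift r i)).
    by rewrite !mul_col_mx !(col_mxEu, col_mxEd) mulNmx [X in X <= 0 -> _]mxE oppr_le0 => -> ->.
  have supp i : y i 0 = 0 -> 0 <= v i 0.
    have := Av (rshift (r + r) i).
    rewrite mul_col_mx col_mxEd mul_diag_mx !mxE mulNr oppr_le0 => + yi.
    by rewrite yi eqxx mul1r.
  have [t t_gt0 [t_ok _]] := ratio_test y_ge0 supp.
  have /opt : ll_feasible T W h x (y + t *: v).
    by split=> //; rewrite mulmxDr -scalemxAr Wv scaler0 addr0.
  rewrite !dotvE mulmxDr -scalemxAr [X in _ <= X]mxE lerDl [X in _ <= X]mxE.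
  by rewrite pmulr_rge0.
pose l1 := lsubmx (lsubmx l); pose l2 := rsubmx (lsubmx l); pose l3 := rsubmx l.
have lE : l = row_mx (row_mx l1 l2) l3 by rewrite !hsubmxK.
have l3_ge0 i : 0 <= l3 0 i by rewrite mxE.
have qE : q - W^T *m (l2 - l1)^T = - (l3 *m D)^T.
  apply: trmx_inj; rewrite linearB /= trmx_mul !trmxK linearN /= trmxK.
  rewrite -[q^T]opprK cE lE !mul_row_col mulmxN mulmxBl.
  move: (l1 *m W) (l2 *m W) (l3 *m D) => X Y Z.
  by apply/matrixP => i j; rewrite !mxE; ring.
have sE i : (q - W^T *m (l2 - l1)^T) i 0 = l3 0 i * (y i 0 == 0)%:R.
  by rewrite qE mul_mx_diag !mxE mulrN opprK.
exists (l2 - l1)^T => i.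
  by rewrite -subr_ge0; have := sE i; rewrite [LHS]mxE [X in _ + X]mxE => ->; rewrite mulr_ge0.
by move=> /negbTE yi; rewrite sE yi mulr0.
Qed.
End LowerLevel.

Definition mx_height p s (M : 'M[rat]_(p, s)) : rat := \prod_i \prod_j height (M i j).

Lemma mx_height_ge1 p s (M : 'M[rat]_(p, s)) : 1 <= mx_height M.
Proof. by apply: prodr_ge1 => i; apply: prodr_ge1 => j; apply: height_ge1. Qed.

Lemma mx_height_row p s1 s2 (M1 : 'M_(p, s1)) (M2 : 'M_(p, s2)) :
  mx_height (row_mx M1 M2) = mx_height M1 * mx_height M2.
Proof.
rewrite -big_split; apply: eq_bigr => i _ /=; rewrite big_split_ord.
by congr (_ * _); apply: eq_bigr => j _; rewrite ?row_mxEl ?row_mxEr.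
Qed.

Lemma mx_height_tr p s (M : 'M_(p, s)) : mx_height M^T = mx_height M.
Proof.
by rewrite /mx_height exchange_big; do 2!apply: eq_bigr => ? _; rewrite mxE.
Qed.

Lemma mx_height_col p1 p2 s (M1 : 'M_(p1, s)) (M2 : 'M_(p2, s)) :
  mx_height (col_mx M1 M2) = mx_height M1 * mx_height M2.
Proof. by rewrite -mx_height_tr tr_col_mx mx_height_row !mx_height_tr. Qed.

Lemma mx_heightN p s (M : 'M_(p, s)) : mx_height (- M) = mx_height M.
Proof.
do 2!apply: eq_bigr => ? _.
by rewrite mxE /height normrN; congr (_ * _%:~R); exact: denqN.
Qed.

Lemma mx_height1 p : mx_height (1%:M : 'M_p) = 2 ^+ p.
Proof.
rewrite -[p in RHS]card_ord -prodr_const; apply: eq_bigr => i _.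
rewrite (bigD1 i) //= big1 => [|j ji]; rewrite !mxE ?eqxx.
  by rewrite mulr1 /height.
by rewrite eq_sym (negbTE ji).
Qed.

(** * Bounds that make the big-M reformulation correct *)

Lemma milp_blp_feasible (R : realType) n m k r (q : 'cV[R]_m)
    (A : 'M[R]_(k, n)) (B : 'M[R]_(k, m)) (a : 'cV[R]_k)
    (T : 'M[R]_(r, n)) (W : 'M[R]_(r, m)) (h : 'cV[R]_r) (Mp Md : R) x y lam z :
  milp_feasible q A B a T W h Mp Md x y lam z -> blp_feasible q A B a T W h x y.
Proof.
move=> [Axy [x_ge0 [Txy [y_ge0 [dual [yM sM]]]]]].
split=> //; split=> //; apply: (@kkt_ll_optimal _ _ _ _ _ _ _ _ _ _ lam) => // i.
have s_ge0 : 0 <= (q - W^T *m lam) i 0.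
  by have := dual i; rewrite -subr_ge0 [in X in _ -> X]mxE [X in _ -> _ <= _ + X]mxE.
(* Whatever [Mp] and [Md] are, either value of [z i] forces [y i] or the slack to be both at most
   and at least 0. *)
move: (yM i) (sM i) (y_ge0 i) s_ge0; case: (z i); rewrite ?subrr mulr0.
  by move=> y0 _ y0'; rewrite (le_anti (introT andP (conj y0 y0'))) mul0r.
by move=> _ s0 _ s0'; rewrite (le_anti (introT andP (conj s0 s0'))) mulr0.
Qed.

Lemma indep_columns_height (F : realFieldType) p N (M : 'M[rat]_(p, N)) (b : 'cV[rat]_p)
    (u : 'cV[F]_N) :
  map_mx ratr M *m u = map_mx ratr b ->
  (forall v : 'cV[F]_N, (forall i, u i 0 = 0 -> v i 0 = 0) ->
     map_mx ratr M *m v = 0 -> v = 0) ->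
  forall j, u j 0 <= ratr (mx_height M * mx_height b).
Proof.
move=> Mu indep j; apply: le_trans (ler_norm _) _.
rewrite /mx_height; under [X in _ * X]eq_bigr do rewrite big_ord1.
exact: indep_columns_bound.
Qed.

(** Feasible points of the mixed-integer program are feasible for (BLP), so it suffices to fit one
    optimal point within the bounds. In the second bound [W] counts twice because [lam] is split
    into two nonnegative parts, and [2 ^+ m] is the height of the identity block of the slack. *)
Lemma bilevel_correct_bound (R : realType) n m k r (c : 'cV[rat]_n) (d q : 'cV[rat]_m)
    (A : 'M[rat]_(k, n)) (B : 'M[rat]_(k, m)) (a : 'cV[rat]_k)
    (T : 'M[rat]_(r, n)) (W : 'M[rat]_(r, m)) (h : 'cV[rat]_r) (Mp Md : rat) :
  mx_height (block_mx A B T W) * mx_height (col_mx a h) <= Mp ->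
  mx_height W ^+ 2 * 2 ^+ m * mx_height q <= Md ->
  bilevel_correct (rmx R c) (rmx R d) (rmx R q) (rmx R A) (rmx R B)
      (rmx R a) (rmx R T) (rmx R W) (rmx R h) (ratr Mp) (ratr Md).
Proof.
move=> leMp leMd x y [[x_ge0 [Axy opt]] min].
have [lam dual compl] := ll_optimal_multiplier opt.
have [Txy y_ge0] := opt.1.
pose M1 := block_mx A B T W; pose M2 := row_mx (row_mx W^T (- W^T)) 1%:M.
have M1E (u : 'cV[R]_n) (v : 'cV[R]_m) : map_mx ratr M1 *m col_mx u v =
    col_mx (rmx R A *m u + rmx R B *m v) (rmx R T *m u + rmx R W *m v).
  by rewrite map_block_mx mul_block_col.
have M2E (u v : 'cV[R]_r) (w : 'cV[R]_m) :
    map_mx ratr M2 *m col_mx (col_mx u v) w = (rmx R W)^T *m (u - v) + w.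
  rewrite !map_row_mx !mul_row_col map_mxN map_mx1 mul1mx map_trmx.
  by rewrite mulNmx mulmxBr.
have [i||u1 [u1_ge0 supp1 Mu1 fu1 indep1]] := @basic_optimal_solution _ _ _
    (map_mx ratr M1) (row_mx (rmx R c)^T (rmx R d)^T) (col_mx x y).
- by case: (split_ordP i) => l ->; rewrite ?col_mxEu ?col_mxEd.
(* A competitor with smaller support is still complementary to the same [lam], hence feasible for
   (BLP), so [min] applies to it. *)
- move=> u; rewrite -[u]vsubmxK.
  move: (usubmx u) (dsubmx u) => x' y' xy'_ge0 supp.
  rewrite !M1E => /eq_col_mx[Axy' Txy'].
  rewrite !mul_row_col [leLHS]mxE [leRHS]mxE -!dotvE; apply: min.
  have x'_ge0 i : 0 <= x' i 0 by have := xy'_ge0 (lshift m i); rewrite col_mxEu.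
  have y'_ge0 i : 0 <= y' i 0 by have := xy'_ge0 (rshift n i); rewrite col_mxEd.
  split=> //; split; first by rewrite Axy'.
  apply: (@kkt_ll_optimal _ _ _ _ _ _ _ _ _ _ lam) => // [|i]; first by split; rewrite ?Txy'.
  have [yi|/compl ->] := eqVneq (y i 0) 0; last by rewrite mulr0.
  have := supp (rshift n i); rewrite !col_mxEd => ->; rewrite ?mul0r //.
pose s := rmx R q - (rmx R W)^T *m lam.
have s_ge0 i : 0 <= s i 0.
  by have := dual i; rewrite -subr_ge0 /s [in X in _ -> X]mxE [X in _ -> _ <= _ + X]mxE.
pose lamp : 'cV[R]_r := \col_i Num.max (lam i 0) 0.
pose lamn : 'cV[R]_r := \col_i Num.max (- lam i 0) 0.
have lamE : lamp - lamn = lam.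
  apply/colP => i; rewrite !mxE; case/orP: (le_total 0 (lam i 0)) => l0.
    by rewrite max_l // max_r ?oppr_le0 // subr0.
  by rewrite max_r // max_l ?oppr_ge0 // sub0r opprK.
(* The zero objective reduces this to finding a basic feasible solution of the dual system. *)
have [i||u2 [u2_ge0 supp2 Mu2 _ indep2]] := @basic_optimal_solution _ _ _
    (map_mx ratr M2) 0 (col_mx (col_mx lamp lamn) s).
- case: (split_ordP i) => l ->; rewrite ?col_mxEd ?col_mxEu //.
  by case: (split_ordP l) => l' ->; rewrite ?col_mxEd ?col_mxEu mxE le_max lexx orbT.
- by move=> u _ _ _; rewrite !mul0mx.
have Mu2' : map_mx ratr M2 *m u2 = rmx R q.
  by rewrite Mu2 M2E lamE /s addrC subrK.
have Mu1' : map_mx ratr M1 *m u1 = map_mx ratr (col_mx a h).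
  by rewrite Mu1 M1E Axy Txy map_col_mx.
have bound1 := indep_columns_height Mu1' indep1.
have bound2 := indep_columns_height Mu2' indep2.
move: Mu1 Mu2 fu1 u1_ge0 supp1 u2_ge0 supp2 bound1 bound2 {Mu1' Mu2' indep1 indep2}.
rewrite -[u1]vsubmxK -[u2]vsubmxK -[usubmx u2]vsubmxK.
move: (usubmx u1) (dsubmx u1) (usubmx (usubmx u2)) (dsubmx (usubmx u2)) (dsubmx u2).
move=> x' y' lp ln s' {u1 u2}.
rewrite !M1E !M2E !mul_row_col => /eq_col_mx[Axy' Txy'] Wls fE.
move=> xy'_ge0 suppy ls'_ge0 supps boundy bounds.
have x'_ge0 i : 0 <= x' i 0 by have := xy'_ge0 (lshift m i); rewrite col_mxEu.
have y'_ge0 i : 0 <= y' i 0 by have := xy'_ge0 (rshift n i); rewrite col_mxEd.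
have s'_ge0 i : 0 <= s' i 0 by have := ls'_ge0 (rshift (r + r) i); rewrite col_mxEd.
have s'E : rmx R q - (rmx R W)^T *m (lp - ln) = s'.
  have <- : (rmx R W)^T *m (lp - ln) + s' = rmx R q by rewrite Wls lamE addrC subrK.
  by rewrite [X in X - _]addrC addrK.
have feas : milp_feasible (rmx R q) (rmx R A) (rmx R B) (rmx R a) (rmx R T) (rmx R W)
    (rmx R h) (ratr Mp) (ratr Md) x' y' (lp - ln) (fun i => y' i 0 == 0).
  split; first by rewrite Axy'.
  split=> //; split; first by rewrite Txy'.
  split=> //; split.
    move=> i; rewrite -subr_ge0.
    by have := s'_ge0 i; rewrite -s'E [in X in X -> _]mxE [X in _ <= _ + X -> _]mxE.
  rewrite s'E; split=> i; have [y'i|y'i] := eqVneq (y' i 0) 0.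
  - by rewrite y'i subrr mulr0.
  - rewrite subr0 mulr1; have := boundy (rshift n i); rewrite col_mxEd => /le_trans->//.
    by rewrite ler_rat.
  - rewrite mulr1; have := bounds (rshift (r + r) i); rewrite col_mxEd => /le_trans->//.
    by rewrite ler_rat !mx_height_row mx_heightN mx_height_tr mx_height1 -expr2.
  (* If [y' i] is nonzero then so is [y i]; hence the old slack vanishes at [i], and with it the new
     one. *)
  - rewrite mulr0; have := supps (rshift (r + r) i); rewrite !col_mxEd => -> //.
    apply: compl; apply: contraNneq y'i => yi.
    by have := suppy (rshift n i); rewrite !col_mxEd yi => ->.
have objE : blp_obj (rmx R c) (rmx R d) x' y' = blp_obj (rmx R c) (rmx R d) x y.
  have := congr1 (fun M : 'M[R]_1 => M 0 0) fE.
  by rewrite /= [LHS]mxE [RHS]mxE -!dotvE.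
exists x', y', (lp - ln), (fun i => y' i 0 == 0); split=> //; split=> //.
move=> x'' y'' lam'' z'' /milp_blp_feasible/min; by rewrite objE.
Qed.

(** * A Turing machine printing the two bounds *)

Inductive phase :=
  | Fill | Open1 | Open2 | Open3 | Open4 | Back | Find | Grow1 | Grow2
  | Close1 | Close2 | Close3 | Close4 | Rewind | Halt.

Definition phase_ord (p : phase) : 'I_15 :=
  match p with
  | Fill => @Ordinal 15 0 isT | Open1 => @Ordinal 15 1 isT
  | Open2 => @Ordinal 15 2 isT | Open3 => @Ordinal 15 3 isT
  | Open4 => @Ordinal 15 4 isT | Back => @Ordinal 15 5 isT
  | Find => @Ordinal 15 6 isT | Grow1 => @Ordinal 15 7 isT
  | Grow2 => @Ordinal 15 8 isT | Close1 => @Ordinal 15 9 isT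
  | Close2 => @Ordinal 15 10 isT | Close3 => @Ordinal 15 11 isT
  | Close4 => @Ordinal 15 12 isT | Rewind => @Ordinal 15 13 isT
  | Halt => @Ordinal 15 14 isT
  end.

Definition ord_phase (s : 'I_15) : phase :=
  nth Halt [:: Fill; Open1; Open2; Open3; Open4; Back; Find; Grow1; Grow2;
               Close1; Close2; Close3; Close4; Rewind] s.

(* [Fill] overwrites the input with separators and [Open1]-[Open4] append
   [1#1#0]. Each round [Find]-[Grow1]-[Grow2]-[Back] turns the first remaining
   input cell into [0] and appends [00] at the right end. Once no input cell is
   left, [Close1]-[Close4] append [1#1#] and [Rewind] returns to the left end. *)
Definition phase_step (p : phase) (x : sym) : phase * sym * move :=
  match p, x with
  | Fill, SBlank => (Open1, S1, MRight)
  | Fill, _ => (Fill, SSep, MRight)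
  | Open1, _ => (Open2, SSep, MRight)
  | Open2, _ => (Open3, S1, MRight)
  | Open3, _ => (Open4, SSep, MRight)
  | Open4, _ => (Back, S0, MLeft)
  | Back, SBlank => (Find, SBlank, MRight)
  | Back, _ => (Back, x, MLeft)
  | Find, SSep => (Grow1, S0, MRight)
  | Find, S1 => (Close1, S1, MRight)
  | Find, _ => (Find, x, MRight)
  | Grow1, SBlank => (Grow2, S0, MRight)
  | Grow1, _ => (Grow1, x, MRight)
  | Grow2, _ => (Back, S0, MLeft)
  | Close1, SBlank => (Close2, S1, MRight)
  | Close1, _ => (Close1, x, MRight)
  | Close2, _ => (Close3, SSep, MRight)
  | Close3, _ => (Close4, S1, MRight)
  | Close4, _ => (Rewind, SSep, MLeft)
  | Rewind, SBlank => (Halt, SBlank, MRight)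
  | Rewind, _ => (Rewind, x, MLeft)
  | Halt, _ => (Halt, x, MStay)
  end.

Definition bigM_machine : TM :=
  {| tm_N := 14; tm_start := phase_ord Fill; tm_halt := phase_ord Halt;
     tm_delta := fun s x =>
       let: (p, w, mv) := phase_step (ord_phase s) x in (phase_ord p, w, mv) |}.

(** The scanned cell and everything to its right form one list, read as blank when empty, so that
    sweeps act on concatenations. *)
Definition tape (p : phase) (l rt : seq sym) : config bigM_machine :=
  @Config bigM_machine (phase_ord p) l (head SBlank rt) (behead rt).

Notation step := (@tm_step bigM_machine).

Lemma tm_init_tape (w : seq sym) : tm_init bigM_machine w = tape Fill [::] w.
Proof. by case: w. Qed.

Lemma step_right p p' x l rt :
  phase_step p (head SBlank rt) = (p', x, MRight) ->
  step (tape p l rt) = tape p' (x :: l) (behead rt).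
Proof.
have E q : ord_phase (phase_ord q) = q by case: q.
(* The halting test fails because [Halt] has only [MStay] instructions. *)
rewrite /tape /= E => Ep; rewrite ifF; last by case: p Ep.
by rewrite Ep; case: rt {Ep} => [|? []].
Qed.

Lemma step_left p p' x l rt :
  phase_step p (head SBlank rt) = (p', x, MLeft) ->
  step (tape p l rt) = tape p' (behead l) (head SBlank l :: x :: behead rt).
Proof.
have E q : ord_phase (phase_ord q) = q by case: q.
rewrite /tape /= E => Ep; rewrite ifF; last by case: p Ep.
by rewrite Ep; case: l.
Qed.

Arguments tm_step : simpl never.

Lemma sweep_right (P : pred sym) (g : sym -> sym) p u l rt :
  (forall x, P x -> phase_step p x = (p, g x, MRight)) -> all P u ->
  iter (size u) step (tape p l (u ++ rt)) = tape p (rev (map g u) ++ l) rt.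
Proof.
move=> Pstep; elim: u l => [|x u IH] l //= /andP[Px Pu].
by rewrite -iterS iterSr (@step_right p p (g x)) ?Pstep //= IH // rev_cons cat_rcons.
Qed.

Definition nonblank (x : sym) : bool := if x is SBlank then false else true.

(** The flag [b] tells whether the blank left of the word is already a tape cell: it is not on the
    first return, but is on every later one. The count covers the cells of [x :: u] and the turn at
    the blank. *)
Lemma sweep_left p p' u (b : bool) x rt :
  (forall x, nonblank x -> phase_step p x = (p, x, MLeft)) ->
  phase_step p SBlank = (p', SBlank, MRight) ->
  all nonblank (x :: u) ->
  iter (size u).+2 step (tape p (u ++ nseq b SBlank) (x :: rt)) =
  tape p' [:: SBlank] (rev u ++ x :: rt).
Proof.
move=> Pstep Bstep; elim: u x rt => [|y u IH] x rt; rewrite /= ?andbT.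
  move=> Px; rewrite (@step_left _ p x) ?Pstep //=.
  by case: b => /=; rewrite (@step_right p p' SBlank).
case/and3P=> Px Py Pu; rewrite -!iterS iterSr (@step_left _ p x) ?Pstep //=.
by rewrite -!iterS IH /= ?Py // rev_cons cat_rcons.
Qed.

(** The common tail of all encoded powers of two: leading bit, separator, denominator 1,
    separator. *)
Definition one_enc : seq sym := [:: S1; SSep; S1; SSep].

Definition work_tape (i j l : nat) : config bigM_machine :=
  tape Find [:: SBlank] (nseq i S0 ++ nseq j SSep ++ one_enc ++ nseq l S0).

Lemma all_nonblank_nseq i x : nonblank x -> all nonblank (nseq i x).
Proof. by rewrite all_nseq orbC => ->. Qed.


Lemma cat_nseqS (X : Type) i (x : X) s : nseq i x ++ x :: s = nseq i.+1 x ++ s.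
Proof. by rewrite -cat_rcons -cats1 -[in RHS]addn1 nseqD. Qed.

Lemma work_tape_init (w : seq sym) : all nonblank w ->
  iter ((size w).*2 + 10) step (tape Fill [::] w) = work_tape 0 (size w) 1.
Proof.
move=> nbw.
rewrite (_ : _ + _ = (size w + 3).+2 + (5 + size w))%N; last by lia.
rewrite iterD [iter (5 + _) _ _]iterD -[X in tape Fill _ X]cats0.
rewrite (@sweep_right nonblank (fun=> SSep)) //; last by case.
rewrite cats0 (_ : map _ w = nseq (size w) SSep); last first.
  by elim: w {nbw} => //= _ w ->.
rewrite rev_nseq [iter 5 _ _]/=.
rewrite (@step_right Fill Open1 S1) // (@step_right Open1 Open2 SSep) //.
rewrite (@step_right Open2 Open3 S1) // (@step_right Open3 Open4 SSep) //.
rewrite (@step_left Open4 Back S0) //= -!iterS.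
rewrite (_ : _ + 3 = size [:: S1, SSep, S1 & nseq (size w) SSep])%N; last first.
  by rewrite /= size_nseq addn3.
have := @sweep_left Back Find [:: S1, SSep, S1 & nseq (size w) SSep] false SSep [:: S0].
rewrite cats0 => ->; rewrite //= ?all_nonblank_nseq //; last by case.
by rewrite !rev_cons rev_nseq -!cats1 -!catA.
Qed.

Lemma sweep_zeros i l rt :
  iter i step (tape Find l (nseq i S0 ++ rt)) = tape Find (nseq i S0 ++ l) rt.
Proof.
have := @sweep_right (fun x => if x is S0 then true else false) id Find (nseq i S0) l rt.
by rewrite size_nseq map_id rev_nseq; apply; [case | rewrite all_nseq orbT].
Qed.

(** Every input cell contributes one zero to the first number and two to the second, whence the
    exponents [L - 1] and [2 L] once a sign symbol is accounted for in each. *)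
Lemma work_tape_round i j l :
  iter ((i + j + l).*2 + 14) step (work_tape i j.+1 l) = work_tape i.+1 j l.+2.
Proof.
set u := nseq j SSep ++ one_enc ++ nseq l S0.
have su : size u = (j + (4 + l))%N by rewrite !size_cat !size_nseq.
have nbu : all nonblank u by rewrite !all_cat /= !all_nonblank_nseq.
rewrite (_ : _ + _ = (size u + i.+1).+2 + (2 + (size u + (1 + i))))%N; last by lia.
rewrite 3!iterD [iter (1 + i) _ _]iterD /work_tape.
rewrite sweep_zeros [iter 1 _ _]/= (@step_right _ Grow1 S0) //.
rewrite [behead _]/= -/u -[X in tape _ _ X]cats0 (@sweep_right nonblank id) //; last by case.
rewrite map_id [iter 2 _ _]/= (@step_right _ Grow2 S0) // (@step_left _ Back S0) //= -!iterS.
rewrite (_ : size u + i.+1 = size (rev u ++ S0 :: nseq i S0))%N; last first.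
  by rewrite size_cat size_rev /= size_nseq.
have := @sweep_left Back Find (rev u ++ S0 :: nseq i S0) true S0 [:: S0].
rewrite -catA => ->; rewrite //= ?all_cat ?all_rev ?nbu ?all_nonblank_nseq //.
- rewrite rev_cat revK rev_cons rev_nseq cat_rcons cat_nseqS /u -!catA /=.
  by rewrite !cat_nseqS cats0.
- by case.
- by rewrite /= all_nonblank_nseq.
Qed.

Lemma work_tape_close i l :
  iter ((i + l).*2 + 16) step (work_tape i 0 l) =
  tape Halt [:: SBlank] (nseq i S0 ++ one_enc ++ nseq l S0 ++ one_enc).
Proof.
set u := [:: SSep; S1; SSep] ++ nseq l S0.
have su : size u = (3 + l)%N by rewrite !size_cat !size_nseq.
have nbu : all nonblank u by rewrite !all_cat /= !all_nonblank_nseq.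
pose v := [:: SSep, S1 & rev u] ++ S1 :: nseq i S0.
have rv : rev v = nseq i S0 ++ S1 :: u ++ [:: S1; SSep].
  by rewrite rev_cat rev_cons rev_nseq cat_rcons 2!rev_cons revK -!cats1 -!catA.
have [s Es] : exists s, s = size v by exists (size v).
have sv : s = (size u + i.+3)%N.
  by rewrite Es su size_cat [size (_ :: _ :: _)]/= size_rev su /= size_nseq; lia.
rewrite (_ : _ + _ = s.+2 + (4 + (size u + (1 + i))))%N; last by lia.
rewrite 3!iterD [iter (1 + i) _ _]iterD /work_tape.
rewrite sweep_zeros [iter 1 _ _]/= (@step_right _ Close1 S1) //.
rewrite [behead _]/= -/u -[X in tape _ _ X]cats0 (@sweep_right nonblank id) //; last by case.
rewrite map_id [iter 4 _ _]/= (@step_right _ Close2 S1) //.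
rewrite (@step_right _ Close3 SSep) // (@step_right _ Close4 S1) //.
rewrite (@step_left _ Rewind SSep) //= -!iterS.
have := @sweep_left Rewind Halt v true S1 [:: SSep].
rewrite -catA -Es => ->; rewrite //= ?all_cat ?all_rev ?nbu ?all_nonblank_nseq //.
- by rewrite rv /u -!catA /= -!catA.
- by case.
- by rewrite /= all_nonblank_nseq.
Qed.

(** The quantity [i + j + l + j.*2] is unchanged by a round, so one [N] bounds the cost of all
    rounds. *)
Lemma work_tape_loop i j l (N : nat) : (i + j + l + j.*2 <= N)%N ->
  exists2 t, (t <= j * (N.*2 + 14))%N &
    iter t step (work_tape i j l) = work_tape (i + j) 0 (l + j.*2).
Proof.
elim: j i l => [|j IH] i l leN; first by exists 0%N; rewrite ?addn0.
have [|t let_ Et] := IH i.+1 l.+2; first by lia.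
exists (t + ((i + j + l).*2 + 14))%N; first by nia.
rewrite iterD work_tape_round Et; congr work_tape; lia.
Qed.

Lemma bin_pow2 K : bin (2 ^ K) = nseq K S0 ++ [:: S1].
Proof.
(* Any fuel above [K] suffices; the induction treats it as a separate variable. *)
rewrite /bin; have := ltn_expl K (isT : 1 < 2)%N; move: {1 2}(2 ^ K)%N => f.
elim: K f => [|K IH] [|f] // ltKf; first by case: f {ltKf}.
by rewrite /= expn_eq0 /= expnS oddM /= mul2n doubleK IH.
Qed.

(** The extra zero is the sign symbol, which coincides with the bit 0. *)
Lemma enc_rat_pow2 K :
  enc_rat (2 ^+ K) = nseq K.+1 S0 ++ one_enc.
Proof.
rewrite (_ : 2 ^+ K = (2 ^ K)%N%:Z%:~R :> rat); last by rewrite -pmulrn natrX.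
by rewrite /enc_rat numq_int denq_int /enc_int /= bin_pow2 -catA.
Qed.

Lemma take_nonblank_id u : all nonblank u -> take_nonblank u = u.
Proof. by elim: u => [|[] u IH] //= /IH ->. Qed.

Lemma bigM_machine_computes (w : seq sym) : all nonblank w -> (0 < size w)%N ->
  exists2 t, (t <= (size w).+1 ^ 8)%N &
    tm_computes_in bigM_machine w t
      (enc_rat (2 ^+ (size w).-1) ++ enc_rat (2 ^+ (size w).*2)).
Proof.
move=> nbw w_gt0; set L := size w in w_gt0 *.
have [|t le_t Et] := @work_tape_loop 0 L 1 (L + 1 + L.*2); first by lia.
exists ((L + (1 + L.*2)).*2 + 16 + (t + (L.*2 + 10)))%N.
  (* The running time is quadratic; the constant [2 ^ 6] is absorbed into the exponent 8 because
     [L.+1] is at least 2. *)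
  have: ((L + (1 + L.*2)).*2 + 16 + (t + (L.*2 + 10)) <= L.+1 ^ 2 * 2 ^ 6)%N.
    by rewrite !expnS !expn0; nia.
  by move/leq_trans; apply; rewrite (expnD _ 2 6) leq_mul2l leq_exp2r ?orbT.
rewrite /tm_computes_in /tm_run tm_init_tape iterD [iter (t + _) _ _]iterD work_tape_init // Et.
rewrite work_tape_close; split => //; rewrite !enc_rat_pow2 prednK // -!catA.
rewrite add1n /tm_output /tape; set u := (X in behead X).
rewrite (_ : _ :: _ = u); first by apply: take_nonblank_id; rewrite /u !all_cat !all_nonblank_nseq.
by rewrite /u; case: (L) w_gt0.
Qed.

(** * Encoding lengths *)

Lemma ltn_pow_size_bin x : (x < 2 ^ size (bin x))%N.
Proof.
rewrite /bin; have := leqnn x; move: {2 4}x => f; elim: f x => [|f IH] x.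
  by rewrite leqn0 => /eqP ->.
case: x => [|x] le_xf //.
have /IH : (x.+1./2 <= f)%N by lia.
rewrite -[bin_aux f.+1 _]/(_ :: bin_aux f x.+1./2) [size (_ :: _)]/= expnS.
by move: (2 ^ _)%N => s; lia.
Qed.

(** Numerator and denominator are each below 2 to their number of bits; the sign and the two
    separators leave a factor 8 that absorbs their sum. *)
Lemma height_le_pow_enc (a : rat) : height a <= 2 ^+ size (enc_rat a).
Proof.
have -> : height a = (`|numq a| + `|denq a|)%N%:R.
  have den_gt0 : 0 < (denq a)%:~R :> rat by rewrite ltr0z denq_gt0.
  rewrite natrD !natr_absz /height mulrDl mul1r addrC; congr (_ + _).
    by rewrite -(gtr0_norm den_gt0) -normrM -numqE intr_norm.
  by rewrite gtr0_norm ?denq_gt0.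
rewrite -natrX ler_nat /enc_rat /enc_int !size_cat /= size_cat /=.
have := ltn_pow_size_bin `|numq a|; have := ltn_pow_size_bin `|denq a|.
have : (0 < `|denq a|)%N by rewrite absz_gt0 denq_neq0.
move: (size (bin `|numq a|)) (size (bin `|denq a|)) => k l.
move: `|numq a|%N `|denq a|%N => x y y_gt0 lty ltx.
rewrite (_ : k.+1 + _ = k + l + 3)%N; last by lia.
rewrite !expnD; nia.
Qed.

Lemma size_enc_mat p s (M : 'M[rat]_(p, s)) :
  size (enc_mat M) = (\sum_i \sum_j size (enc_rat (M i j)))%N.
Proof.
rewrite size_flatten /shape sumnE !big_map ?big_enum /=; apply: eq_bigr => i _.
by rewrite size_flatten /shape sumnE !big_map ?big_enum.
Qed.

Lemma mx_height_le_pow_enc p s (M : 'M[rat]_(p, s)) :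
  mx_height M <= 2 ^+ size (enc_mat M).
Proof.
rewrite size_enc_mat -prodrXr.
have h_ge0 a : 0 <= height a by rewrite (le_trans _ (height_ge1 _)).
apply: ler_prod => i _; rewrite prodr_ge0 //= -prodrXr.
by apply: ler_prod => j _; rewrite h_ge0 height_le_pow_enc.
Qed.

(** Applied to [d], this pays for the factor [2 ^+ m] in the dual bound. *)
Lemma leq_size_enc_col p (v : 'cV[rat]_p) : (p <= size (enc_mat v))%N.
Proof.
rewrite size_enc_mat -[leqLHS]card_ord -sum1_card leq_sum // => i _.
by rewrite big_ord1 /enc_rat /enc_int.
Qed.

Lemma nonblank_bin x : all nonblank (bin x).
Proof.
rewrite /bin; move: {1}x => f; elim: f x => //= f IH x; case: ifP => //= _.
by rewrite IH andbT; case: odd.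
Qed.

Lemma nonblank_enc_rat (a : rat) : all nonblank (enc_rat a).
Proof.
by rewrite /enc_rat /enc_int !all_cat /= all_cat /= !nonblank_bin; case: ifP.
Qed.

Lemma nonblank_enc_mat p s (M : 'M[rat]_(p, s)) : all nonblank (enc_mat M).
Proof.
rewrite /enc_mat; elim: (enum 'I_p) => //= i I IH; rewrite all_cat IH andbT.
elim: (enum 'I_s) => //= j J IHJ; rewrite all_cat IHJ andbT.
exact: nonblank_enc_rat.
Qed.

Theorem theorem4 (R : realType) :
  exists (M : TM) (e : nat),
  forall (n m k r : nat) (c : 'cV[rat]_n) (d q : 'cV[rat]_m)
    (A : 'M[rat]_(k, n)) (B : 'M[rat]_(k, m)) (a : 'cV[rat]_k)
    (T : 'M[rat]_(r, n)) (W : 'M[rat]_(r, m)) (h : 'cV[rat]_r),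
  let w := enc_blp c d q A B a T W h in
  exists (t : nat) (Mp Md : rat),
    (t <= (size w).+1 ^ e)%N /\
    tm_computes_in M w t (enc_rat Mp ++ enc_rat Md) /\
    bilevel_correct (rmx R c) (rmx R d) (rmx R q) (rmx R A) (rmx R B)
      (rmx R a) (rmx R T) (rmx R W) (rmx R h) (ratr Mp) (ratr Md).
Proof.
exists bigM_machine, 8%N => n m k r c d q A B a T W h w.
have nbw : all nonblank w.
  by rewrite !all_cat /= !nonblank_bin !nonblank_enc_mat.
(* The 4 comes from the separators closing the four dimensions; it covers the loss of one in
   [(size w).-1]. *)
have sw : (4 + size (enc_mat d) + size (enc_mat q) + size (enc_mat A) +
    size (enc_mat B) + size (enc_mat a) + size (enc_mat T) + size (enc_mat W) +
    size (enc_mat h) <= size w)%N.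
  by rewrite /w /enc_blp /enc_nat !size_cat /=; lia.
have [|t le_t run_t] := bigM_machine_computes nbw; first by lia.
exists t, (2 ^+ (size w).-1), (2 ^+ (size w).*2); split=> //; split=> //.
have le2 (i j : nat) : (i <= j)%N -> 2 ^+ i <= 2 ^+ j :> rat.
  by move=> leij; rewrite -!natrX ler_nat leq_exp2l.
have h_ge0 p s (M : 'M[rat]_(p, s)) : 0 <= mx_height M.
  by rewrite (le_trans _ (mx_height_ge1 _)).
apply: bilevel_correct_bound.
  rewrite /block_mx !mx_height_col !mx_height_row.
  apply: (@le_trans _ _ (2 ^+ ((size (enc_mat A) + size (enc_mat B)) +
    (size (enc_mat T) + size (enc_mat W)) + (size (enc_mat a) + size (enc_mat h))))).
    by rewrite !exprD !ler_pM ?mulr_ge0 ?mx_height_le_pow_enc.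
  by apply: le2; lia.
(* The doubled contribution of [W] is what calls for the exponent [2 L]. *)
apply: (@le_trans _ _ (2 ^+ (size (enc_mat W) * 2 + m + size (enc_mat q)))).
  by rewrite !exprD exprM !ler_pM ?mulr_ge0 ?exprn_ge0 ?mx_height_le_pow_enc //.
by apply: le2; have := leq_size_enc_col d; lia.
Qed.
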